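(* Let $X$ and $Y$ be topological spaces with power sets $\mathcal{P}(X)$ and $\mathcal{P}(Y)$. Let $T_X=\{\operatorname{Id}_X,\operatorname{Cl}_X\}$, where $\operatorname{Id}_X$ is the identity function on $\mathcal{P}(X)$ and $\operatorname{Cl}_X:\mathcal{P}(X)\to\mathcal{P}(X)$ is $A\mapsto\overline{A}$, and let $T_Y=\{\operatorname{Id}_Y,\operatorname{Cl}_Y\}$ be defined analogously on $\mathcal{P}(Y)$. Let $p:X\to Y$ be a map and let $p^*:\mathcal{P}(X)\to\mathcal{P}(Y)$ be defined by $p^*(A)=\overline{p(A)}$ if $A$ is closed in $X$, and $p^*(A)=p(A)$ if $A$ is not closed in $X$, where $p(A)=\{p(x):x\in A\}$. Let $\theta$ be the map from $T_X$ to $T_Y$ given by $\theta(\operatorname{Id}_X)=\operatorname{Id}_Y$ and $\theta(\operatorname{Cl}_X)=\operatorname{Cl}_Y$. Then $p$ is continuous if and only if $p^*$ is a $\theta$-morphism.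
   Context: An operator semigroup on a set $D$ is a set $T$ of functions $D\to D$ closed under composition. For $U\subseteq D$, $\langle U\rangle_T=\{f(u):f\in T,u\in U\}$, and a $T$-space is a subset of $D$ of this form. $T_X$ and $T_Y$ are operator semigroups on $\mathcal{P}(X)$ and $\mathcal{P}(Y)$, and $\mathcal{P}(X)$, $\mathcal{P}(Y)$ are a $T_X$-space and a $T_Y$-space, respectively. For operator semigroups $T_1,T_2$, a map $\theta:T_1\to T_2$, and a map $\phi$ from a $T_1$-space $S$ to a $T_2$-space, $\phi$ is called a $\theta$-morphism if $\phi(f(a))=\theta(f)(\phi(a))$ for all $f\in T_1$ and $a\in S$. *)

(* Defs.v *)
From HB Require Import structures.
From mathcomp Require Import all_boot all_classical.
From mathcomp Require Export topology.

Set Implicit Arguments.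
Unset Strict Implicit.
Unset Printing Implicit Defensive.

Local Open Scope classical_set_scope.

Record op_semigroup (D : Type) := OpSemigroup {
  op_semigroup_set :> set (D -> D);
  op_semigroup_comp : forall f g : D -> D,
    op_semigroup_set f -> op_semigroup_set g -> op_semigroup_set (f \o g)
}.

Definition op_span (D : Type) (T : set (D -> D)) (U : set D) : set D :=
  [set f u | f in T & u in U].

Record op_space (D : Type) (T : op_semigroup D) := OpSpace {
  op_space_set :> set D;
  op_spaceP : exists U : set D, op_space_set = op_span T U
}.

(* [T1 -> T2] is a map between the sets of functions themselves: each semigroup
   is read as the subtype of its members, and [val f] is the function
   underlying the member [f].  The first conjunct says that [phi], given on
   all of [D1], restricts to a map from [S1] to [S2]. *)
Definition op_morphism (D1 D2 : Type) (T1 : op_semigroup D1)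
    (T2 : op_semigroup D2) (theta : T1 -> T2) (S1 : op_space T1)
    (S2 : op_space T2) (phi : D1 -> D2) : Prop :=
  set_fun S1 S2 phi /\
  forall (f : T1) (a : D1), op_space_set S1 a -> phi (val f a) = val (theta f) (phi a).

Lemma closure_ops_comp (X : topologicalType) (f g : set X -> set X) :
  [set id; closure] f -> [set id; closure] g -> [set id; closure] (f \o g).
Proof.
move=> [->|->] [->|->]; [by left | by right | by right | right].
apply/funext => A /=; apply/esym/closure_id; exact: closed_closure.
Qed.

Definition closure_ops (X : topologicalType) : op_semigroup (set X) :=
  OpSemigroup (@closure_ops_comp X).

Lemma id_in_closure_ops (X : topologicalType) : id \in (closure_ops X : set _).
Proof. by apply/mem_set; left. Qed.

Lemma closure_in_closure_ops (X : topologicalType) :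
  closure \in (closure_ops X : set _).
Proof. by apply/mem_set; right. Qed.

(* [id_op X] and [closure_op X] are equal when [X] is discrete. *)
Definition id_op (X : topologicalType) : closure_ops X :=
  exist _ id (id_in_closure_ops X).

Definition closure_op (X : topologicalType) : closure_ops X :=
  exist _ closure (closure_in_closure_ops X).

Lemma power_set_op_span (X : topologicalType) :
  exists U : set (set X), setT = op_span (closure_ops X) U.
Proof.
exists setT; apply/esym/seteqP; split=> // A _.
by exists id; [left | exists A].
Qed.

Definition power_set_space (X : topologicalType) : op_space (closure_ops X) :=
  OpSpace (power_set_op_span X).

Definition star_map (X Y : topologicalType) (p : X -> Y) (A : set X) : set Y :=
  if `[< closed A >] then closure (p @` A) else p @` A.

(* Main.v *)
Require Import Defs.
From mathcomp Require Import all_boot all_classical topology.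

(** A map [p] is continuous exactly when it sends adherent points to adherent
    points, [p (closure A) `<=` closure (p A)] for all [A]
    ([continuous_image_closureP]).  This inclusion is equivalent to the equality
    [closure (p (closure A)) = closure (p A)], and that equality is commutation
    of [star_map p] with closure: [star_map p] closes up images of closed sets,
    so its value at [closure A] is the left-hand side, while the closure of its
    value at [A] is the right-hand side, whether or not [A] is closed.
    Commutation with the identity is automatic, and identity and closure are the
    only operators. *)

Local Open Scope classical_set_scope.

Lemma closureK (X : topologicalType) (A : set X) :
  closure (closure A) = closure A.
Proof. exact/esym/closure_id/closed_closure. Qed.

(** For the converse, the inclusion applied to the preimage of a closed set [B]
    puts the image of [closure (p @^-1` B)] inside [closure B = B], so that
    this preimage is closed. *)
Lemma continuous_image_closureP (X Y : topologicalType) (p : X -> Y) :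
  continuous p <->
  forall A : set X, p @` closure A `<=` closure (p @` A).
Proof.
split=> [cp A _ [x clAx <-] V /cp/clAx[z [Az Vz]]|clp].
  by exists (p z); split => //; exists z.
apply/continuous_closedP => B /closure_id clB x clx.
rewrite /preimage /= clB.
apply: (closureS (@image_preimage_subset _ _ p B)).
by apply: clp; exists x.
Qed.

Lemma image_closure_subsetP (X Y : topologicalType) (p : X -> Y) (A : set X) :
  p @` closure A `<=` closure (p @` A) <->
  closure (p @` closure A) = closure (p @` A).
Proof.
split=> [clp|<-]; last exact: subset_closure.
apply/seteqP; split.
  by rewrite -[X in _ `<=` X]closureK; exact: closureS.
exact/closureS/image_subset/subset_closure.
Qed.

Lemma star_map_closure (X Y : topologicalType) (p : X -> Y) (A : set X) :
  star_map p (closure A) = closure (p @` closure A).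
Proof. by rewrite /star_map asboolT //; exact: closed_closure. Qed.

Lemma closure_star_map (X Y : topologicalType) (p : X -> Y) (A : set X) :
  closure (star_map p A) = closure (p @` A).
Proof. by rewrite /star_map; case: ifP; rewrite ?closureK. Qed.

(** An operator is determined by its underlying function, membership being
    a boolean equation. *)
Lemma closure_opsP (X : topologicalType) (f : closure_ops X) :
  f = id_op X \/ f = closure_op X.
Proof.
by case: (set_valP f) => fE; [left | right]; exact: val_inj.
Qed.

Lemma op_morphism_star_mapP (X Y : topologicalType) (p : X -> Y)
    (theta : closure_ops X -> closure_ops Y)
    (theta_id : theta (id_op X) = id_op Y)
    (theta_closure : theta (closure_op X) = closure_op Y) :
  op_morphism theta (power_set_space X) (power_set_space Y) (star_map p) <->
  forall A : set X, star_map p (closure A) = closure (star_map p A).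
Proof.
split=> [[_ mor] A|comm].
  by have := mor (closure_op X) A I; rewrite theta_closure.
split=> // f A _; case: (closure_opsP _ f) => ->.
  by rewrite theta_id.
by rewrite theta_closure; exact: comm.
Qed.

Theorem proposition6p1p3 (X Y : topologicalType) (p : X -> Y)
    (theta : closure_ops X -> closure_ops Y)
    (theta_id : theta (id_op X) = id_op Y)
    (theta_closure : theta (closure_op X) = closure_op Y) :
  continuous p <->
  op_morphism theta (power_set_space X) (power_set_space Y) (star_map p).
Proof.
rewrite op_morphism_star_mapP // continuous_image_closureP.
by split=> clp A; have := clp A;
  rewrite star_map_closure closure_star_map image_closure_subsetP.
Qed.
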